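(* Let $a\in\mathbb{C}$ with $a\neq0$. Then the reduced cohomology of the extended Schrödinger-Virasoro conformal algebra with coefficients in its one-dimensional module $\mathbb{C}_a$ vanishes: $H^q(\widetilde{\mathcal{SV}},\mathbb{C}_a)=0$ for every $q\in\mathbb{Z}_+$.
   Context: All vector spaces are over $\mathbb{C}$; $\mathbb{Z}_+$ is the set of nonnegative integers. Lie conformal algebra: a $\mathbb{C}[\partial]$-module $\mathcal{A}$ with a $\mathbb{C}$-bilinear map $\mathcal{A}\otimes\mathcal{A}\to\mathbb{C}[\lambda]\otimes\mathcal{A}$, $a\otimes b\mapsto[a_\lambda b]$, satisfying $[\partial a_\lambda b]=-\lambda[a_\lambda b]$, $[a_\lambda\partial b]=(\partial+\lambda)[a_\lambda b]$, $[a_\lambda b]=-[b_{-\lambda-\partial}a]$, and $[a_\lambda[b_\mu c]]=[[a_\lambda b]_{\lambda+\mu}c]+[b_\mu[a_\lambda c]]$. The extended Schrödinger-Virasoro conformal algebra $\widetilde{\mathcal{SV}}$ is the Lie conformal algebra that is the free $\mathbb{C}[\partial]$-module on $L,N,Y,M$ with $[L_\lambda L]=(\partial+2\lambda)L$, $[L_\lambda Y]=(\partial+\frac32\lambda)Y$, $[L_\lambda M]=(\partial+\lambda)M$, $[L_\lambda N]=(\partial+\lambda)N$, $[Y_\lambda Y]=(\partial+2\lambda)M$, $[N_\lambda Y]=Y$, $[N_\lambda M]=2M$; the brackets in the opposite order are determined by skew-symmetry, and all other brackets of generators are zero. For $a\in\mathbb{C}$, $\mathbb{C}_a$ is the one-dimensional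 module $\mathbb{C}$ with $\partial v=av$ and $x_\lambda v=0$ for all $x\in\mathcal{A}$. Basic complex with coefficients in $\mathbb{C}_a$: an $n$-cochain is a $\mathbb{C}$-linear map $\gamma:\mathcal{A}^{\otimes n}\to\mathbb{C}_a[\lambda_1,\dots,\lambda_n]$, $a_1\otimes\cdots\otimes a_n\mapsto\gamma_{\lambda_1,\dots,\lambda_n}(a_1,\dots,a_n)$, such that (1) $\gamma_{\lambda_1,\dots,\lambda_n}(a_1,\dots,\partial a_i,\dots,a_n)=-\lambda_i\gamma_{\lambda_1,\dots,\lambda_n}(a_1,\dots,a_n)$, and (2) $\gamma$ is skew-symmetric under simultaneous permutations of the $a_i$'s and the $\lambda_i$'s. The space of $n$-cochains is $\widetilde{C}^n(\mathcal{A},\mathbb{C}_a)$, with $\widetilde{C}^0(\mathcal{A},\mathbb{C}_a)=\mathbb{C}_a$. The differential is $d_0=0$ and, for $n\ge1$, $$(d_n\gamma)_{\lambda_1,\dots,\lambda_{n+1}}(a_1,\dots,a_{n+1})=\sum_{1\le i<j\le n+1}(-1)^{i+j}\gamma_{\lambda_i+\lambda_j,\lambda_1,\dots,\hat{\lambda_i},\dots,\hat{\lambda_j},\dots,\lambda_{n+1}}([a_{i\,\lambda_i}a_j],a_1,\dots,\hat{a_i},\dots,\hat{a_j},\dots,a_{n+1}),$$ where $\gamma$ is extended linearly over polynomials in the $\lambda_i$; $d^2=0$. Reduced cohomology: $\partial$ acts on $\widetilde{C}^n(\mathcal{A},\mathbb{C}_a)$ by $(\partial\gamma)_{\lambda_1,\dots,\lambda_n}=(a+\sum_{i=1}^n\lambda_i)\gamma_{\lambda_1,\dots,\lambda_n}$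 and commutes with $d$. The reduced complex is the quotient complex $\widetilde{C}^\bullet(\mathcal{A},\mathbb{C}_a)/\partial\widetilde{C}^\bullet(\mathcal{A},\mathbb{C}_a)$, and $H^q(\mathcal{A},\mathbb{C}_a)$ is its $q$-th cohomology. *)

(* Defs.v *)
From HB Require Import structures.
From mathcomp Require Import all_boot all_order all_algebra all_fingroup.
From mathcomp Require Import finmap reals complex mpoly ring.

Set Implicit Arguments.
Unset Strict Implicit.
Unset Printing Implicit Defensive.

Import Order.TTheory GRing.Theory Num.Theory.

Local Open Scope ring_scope.

(* A C[d]-module is an lmodType {poly C}: d acts as scaling by 'X, and c : C
   as scaling by c%:P.  An element of C[lambda] (x) A is the finitely supported
   function nat -> A of its coefficients; [lbr a b n] is the coefficient of
   lambda^n in [a_lambda b], and each axiom is stated coefficient by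
   coefficient.
   - In lbr_skew, {poly {poly C}} is C[d][lambda], so the scalar is the
     coefficient, in C[d], of lambda^n in (- lambda - d)^k.
   - In lbr_jacobi, {poly {poly C}} is C[mu][lambda], so the scalar is the
     coefficient of lambda^m mu^n in lambda^j (lambda + mu)^k. *)
Record lieConformalAlgebra (C : fieldType) := LieConformalAlgebra {
  lca_sort :> lmodType {poly C};
  lbr : lca_sort -> lca_sort -> {fsfun nat -> lca_sort with 0};
  lbr_linearl : forall (c : C) a a' b n,
    lbr (c%:P *: a + a') b n = c%:P *: lbr a b n + lbr a' b n;
  lbr_linearr : forall (c : C) a b b' n,
    lbr a (c%:P *: b + b') n = c%:P *: lbr a b n + lbr a b' n;
  lbr_dl : forall a b n,
    lbr ('X *: a) b n = - (if n is m.+1 then lbr a b m else 0);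
  lbr_dr : forall a b n,
    lbr a ('X *: b) n =
      'X *: lbr a b n + (if n is m.+1 then lbr a b m else 0);
  lbr_skew : forall a b n,
    lbr a b n =
      - \sum_(k <- finsupp (lbr b a))
          ((- 'X - 'X%:P : {poly {poly C}}) ^+ k)`_n *: lbr b a k;
  lbr_jacobi : forall a b c m n,
    lbr a (lbr b c n) m =
      \sum_(j <- finsupp (lbr a b)) \sum_(k <- finsupp (lbr (lbr a b j) c))
          (('X^j * ('X + 'X%:P) ^+ k : {poly {poly C}})`_m`_n)%:P
            *: lbr (lbr a b j) c k
      + lbr b (lbr a c m) n
}.

Section ReducedCohomology.
Variables (C : fieldType) (A : lieConformalAlgebra C) (a : C).

Implicit Types n : nat.

Definition cofun n := {ffun 'I_n -> A} -> {mpoly C[n]}.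

Definition upd n (v : {ffun 'I_n -> A}) (i : 'I_n) (x : A) :
  {ffun 'I_n -> A} := [ffun j => if j == i then x else v j].

(* Linear maps on the n-th tensor power of A are given as multilinear maps;
   the variable lambda_i is 'X_i.  For n = 0 this is the space of all maps
   from a one-point type to {mpoly C[0]} = C. *)
Definition is_cochain n (gamma : cofun n) : Prop :=
  [/\ forall v i (c : C) x y,
        gamma (upd v i (c%:P *: x + y)) =
          c *: gamma (upd v i x) + gamma (upd v i y),
      forall v i x,
        gamma (upd v i ('X *: x)) = - 'X_i * gamma (upd v i x)
    & forall (v : {ffun 'I_n -> A}) (s : 'S_n),
        gamma [ffun i => v (s i)] \mPo [tuple 'X_(s i) | i < n] =
          (-1) ^+ s * gamma v].

Definition fcons T m (x : T) (f : 'I_m -> T) (p : 'I_m.+1) : T :=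
  if unlift ord0 p is Some q then f q else x.

(* For i < j, the p-th element of 'I_m.+2 once i and j are left out. *)
Definition omit2 m (i j : 'I_m.+2) (p : 'I_m) : 'I_m.+2 :=
  lift j (lift (inord i : 'I_m.+1) p).

(* Indices start at 0 here, which does not change the parity of i + j.  The
   inner sum is the extension of gamma to polynomials in lambda_i: the term
   lambda_i^k (x) [a_i, a_j]_k of the bracket contributes 'X_i^k times gamma. *)
Definition codiffS m (gamma : cofun m.+1) : cofun m.+2 := fun v =>
  \sum_(i < m.+2) \sum_(j < m.+2 | (i < j)%N)
    (-1) ^+ (i + j)%N *
    \sum_(k <- finsupp (lbr (v i) (v j)))
      'X_i ^+ k *
      (gamma [ffun p => fcons (lbr (v i) (v j) k) (v \o omit2 i j) p]
         \mPo [tuple fcons ('X_i + 'X_j) (fun q => 'X_(omit2 i j q)) p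
              | p < m.+1]).

Definition codiff n : cofun n -> cofun n.+1 :=
  match n with
  | 0 => fun _ _ => 0
  | m.+1 => @codiffS m
  end.

(* This is where the coefficients C_a intervene: d acts on C_a by a. *)
Definition coder n (gamma : cofun n) : cofun n := fun v =>
  (a%:MP + \sum_(i < n) 'X_i) * gamma v.

(* Equality of the classes modulo d C^n. *)
Definition reduced_eq n (gamma gamma' : cofun n) : Prop :=
  exists2 phi : cofun n, is_cochain phi &
    forall v, gamma v - gamma' v = coder phi v.

Definition reduced_cocycle n (gamma : cofun n) : Prop :=
  is_cochain gamma /\ reduced_eq (codiff gamma) (fun _ => 0).

(* The complex is zero in degree -1. *)
Definition reduced_coboundary n : cofun n -> Prop :=
  match n with
  | 0 => fun gamma => reduced_eq gamma (fun _ => 0)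
  | m.+1 => fun gamma =>
      exists2 psi : cofun m, is_cochain psi & reduced_eq gamma (codiff psi)
  end.

(* H^q(A, C_a) = 0. *)
Definition reduced_cohomology_vanishes (q : nat) : Prop :=
  forall gamma : cofun q, reduced_cocycle gamma -> reduced_coboundary gamma.

End ReducedCohomology.

Inductive svGen := svL | svN | svY | svM.

Definition svGen_code (g : svGen) : nat :=
  match g with svL => 0 | svN => 1 | svY => 2 | svM => 3 end.
Definition svGen_decode (i : nat) : svGen :=
  match i with 0 => svL | 1 => svN | 2 => svY | _ => svM end.
Lemma svGen_codeK : cancel svGen_code svGen_decode.
Proof. by case. Qed.
HB.instance Definition _ := Countable.copy svGen (can_type svGen_codeK).
Lemma svGen_enumP : Finite.axiom [:: svL; svN; svY; svM].
Proof. by case. Qed.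
HB.instance Definition _ := isFinite.Build svGen svGen_enumP.

Lemma sum_svGen (V : nmodType) (F : svGen -> V) :
  \sum_g F g = F svL + F svN + F svY + F svM.
Proof.
have e : enum {: svGen} = [:: svL; svN; svY; svM] by rewrite enumT unlock.
by rewrite -big_enum e !big_cons big_nil /= addr0 !addrA.
Qed.

Section ExtendedSchrodingerVirasoro.
Variable C : numFieldType.

Local Notation P := {poly C}.
Local Notation PP := {poly {poly C}}.

(* The free C[d]-module on the generators. *)
Definition extSV_sort : lmodType P := {ffun svGen -> P^o}.

(* PP is C[d][lambda]. *)
Local Notation dd := (('X : {poly C})%:P : PP).
Local Notation la := ('X : PP).
Local Notation cst c := ((c : C)%:P%:P : PP).

(* The coordinates of p g, for p in C[d][lambda] and g a generator. *)
Definition svterm (p : PP) (g : svGen) : {ffun svGen -> PP} :=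
  [ffun g' => if g' == g then p else 0].

(* The coordinates of [g_lambda h].  The brackets [Y L], [M L], [N L], [Y N]
   and [M N] are those forced by skew-symmetry. *)
Definition svstruct (g h : svGen) : {ffun svGen -> PP} :=
  match g, h with
  | svL, svL => svterm (dd + 2 * la) svL
  | svL, svY => svterm (dd + cst (3 / 2) * la) svY
  | svL, svM => svterm (dd + la) svM
  | svL, svN => svterm (dd + la) svN
  | svY, svY => svterm (dd + 2 * la) svM
  | svN, svY => svterm 1 svY
  | svN, svM => svterm 2 svM
  | svY, svL => svterm (cst (1 / 2) * dd + cst (3 / 2) * la) svY
  | svM, svL => svterm la svM
  | svN, svL => svterm la svN
  | svY, svN => svterm (- 1) svY
  | svM, svN => svterm (- 2) svM
  | _, _ => [ffun=> 0]
  end.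

(* Sesquilinear extension:
   [(p(d) g)_lambda (q(d) h)] = p(- lambda) q(d + lambda) [g_lambda h]. *)
Definition svbr (a b : extSV_sort) (k : svGen) : PP :=
  \sum_g \sum_h
    ((a g)^:P \Po (- la)) * ((b h)^:P \Po (la + dd)) * svstruct g h k.

Definition svlbr (a b : extSV_sort) : {fsfun nat -> extSV_sort with 0} :=
  [fsfun n in [fset n | n in iota 0 (\max_k size (svbr a b k))]%fset =>
     ([ffun k => (svbr a b k)`_n] : extSV_sort) | 0].

Lemma svlbrE a b n : svlbr a b n = [ffun k => (svbr a b k)`_n].
Proof.
rewrite fsfunE; case: ifPn => //.
rewrite !inE /= mem_iota add0n /= -leqNgt => le_n.
apply/ffunP=> k; rewrite !ffunE nth_default //.
by apply: leq_trans le_n; apply: (leq_bigmax k).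
Qed.

Local Notation M := extSV_sort.

Lemma svbr_ll (p : P) (a a' b : M) k :
  svbr (p *: a + a') b k = (p^:P \Po (- la)) * svbr a b k + svbr a' b k.
Proof.
rewrite /svbr mulr_sumr -big_split /=; apply: eq_bigr => g _.
rewrite mulr_sumr -big_split /=; apply: eq_bigr => h _.
have -> : (p *: a + a') g = p * a g + a' g by rewrite !ffunE.
by rewrite rmorphD rmorphM /= comp_polyD comp_polyM; ring.
Qed.

Lemma svbr_lr (p : P) (a b b' : M) k :
  svbr a (p *: b + b') k = (p^:P \Po (la + dd)) * svbr a b k + svbr a b' k.
Proof.
rewrite /svbr mulr_sumr -big_split /=; apply: eq_bigr => g _.
rewrite mulr_sumr -big_split /=; apply: eq_bigr => h _.
have -> : (p *: b + b') h = p * b h + b' h by rewrite !ffunE.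
by rewrite rmorphD rmorphM /= comp_polyD comp_polyM; ring.
Qed.



(* svstruct, and below svbr, over an arbitrary ring: D is d, L is lambda, h and
   t are 1/2 and 3/2. *)
Definition aS (T : comNzRingType) (D L h t : T) (g g' k : svGen) : T :=
  match g, g', k with
  | svL, svL, svL | svY, svY, svM => D + 2 * L
  | svL, svY, svY => D + t * L
  | svL, svM, svM | svL, svN, svN => D + L
  | svN, svY, svY => 1
  | svN, svM, svM => 2
  | svY, svL, svY => h * D + t * L
  | svM, svL, svM | svN, svL, svN => L
  | svY, svN, svY => - 1
  | svM, svN, svM => - 2
  | _, _, _ => 0
  end.
Definition aB (T : comNzRingType) (D L h t : T) (l r : svGen -> T) k : T :=
  \sum_g \sum_g' l g * r g' * aS D L h t g g' k.

Lemma aB_skew (T : comNzRingType) (D L h t : T) (l r : svGen -> T) k :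
  t = 1 + h -> aB D L h t l r k = - aB D (- L - D) h t r l k.
Proof. by move=> ->; rewrite /aB !sum_svGen; case: k => /=; ring. Qed.


Lemma aS_rmorph (T T' : comNzRingType) (f : {rmorphism T -> T'}) D L h t g g' k :
  f (aS D L h t g g' k) = aS (f D) (f L) (f h) (f t) g g' k.
Proof.
by case: g; case: g'; case: k;
  rewrite /= ?(rmorph0, rmorph1, rmorphN, rmorphD, rmorphM, rmorph_nat).
Qed.

Lemma aBE (T : comNzRingType) (D L h t : T) (l r : svGen -> T) k :
  aB D L h t l r k =
  match k with
  | svL => l svL * r svL * (D + 2 * L)
  | svN => l svL * r svN * (D + L) + l svN * r svL * L
  | svY => l svL * r svY * (D + t * L) + l svN * r svY
     + l svY * r svL * (h * D + t * L) - l svY * r svN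
  | svM => l svL * r svM * (D + L) + l svN * r svM * 2
     + l svY * r svY * (D + 2 * L) + l svM * r svL * L - l svM * r svN * 2
  end.
Proof. by rewrite /aB !sum_svGen; case: k => /=; ring. Qed.

Lemma aB_jacobi (T : numFieldType) (D x y : T) (a b c : svGen -> T) k :
  let B D L l r k := aB D L (1 / 2) (3 / 2) l r k in
  B D x a (B (D + x) y b c) k =
  B D (x + y) (B (- (x + y)) x a b) c k + B D y b (B (D + y) x a c) k.
Proof. by rewrite /= !aBE; case: k => /=; field. Qed.

Lemma aB_suml (T : comNzRingType) (D L h t : T) I (s : seq I) F l r k :
  \sum_(i <- s) F i * aB D L h t (l i) r k
    = aB D L h t (fun g => \sum_(i <- s) F i * l i g) r k.
Proof.
elim: s => [|i s IH].
  by rewrite big_nil aBE !big_nil; case: k; ring.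
by rewrite big_cons IH {IH} !aBE !big_cons; case: k; ring.
Qed.

Lemma aB_sumr (T : comNzRingType) (D L h t : T) I (s : seq I) F l r k :
  \sum_(i <- s) F i * aB D L h t l (r i) k
    = aB D L h t l (fun g => \sum_(i <- s) F i * r i g) k.
Proof.
elim: s => [|i s IH].
  by rewrite big_nil aBE !big_nil; case: k; ring.
by rewrite big_cons IH {IH} !aBE !big_cons; case: k; ring.
Qed.

Lemma eq_aB (T : comNzRingType) (D L h t : T) l l' r r' k :
  l =1 l' -> r =1 r' -> aB D L h t l r k = aB D L h t l' r' k.
Proof. by move=> el er; rewrite /aB !sum_svGen !el !er. Qed.

Lemma svstructE g h k :
  svstruct g h k = aS dd la (cst (1 / 2)) (cst (3 / 2)) g h k.
Proof. by case: g; case: h; case: k; rewrite /= !ffunE. Qed.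

Lemma svbrE (a b : M) k :
  svbr a b k = aB dd la (cst (1 / 2)) (cst (3 / 2))
    (fun g => (a g)^:P \Po (- la)) (fun g => (b g)^:P \Po (la + dd)) k.
Proof.
by apply: eq_bigr => g _; apply: eq_bigr => h _; rewrite svstructE.
Qed.

Lemma svbr_skew (a b : M) k :
  svbr a b k = - (svbr b a k \Po (- la - dd)).
Proof.
have e32 : cst (3 / 2) = 1 + cst (1 / 2).
  by rewrite -!polyC1 -!polyCD; congr _%:P%:P; field.
have E1 (p : P) : (p^:P \Po (- la)) \Po (- la - dd) = p^:P \Po (la + dd).
  by rewrite -comp_polyA rmorphN /= comp_polyX opprD !opprK.
have E2 (p : P) : (p^:P \Po (la + dd)) \Po (- la - dd) = p^:P \Po (- la).
  by rewrite -comp_polyA comp_polyD comp_polyX comp_polyC subrK.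
rewrite !svbrE aB_skew //; congr (- _).
rewrite /aB rmorph_sum /=; apply: eq_bigr => g _.
rewrite rmorph_sum /=; apply: eq_bigr => h _.
rewrite !rmorphM /= E1 E2; congr (_ * _).
rewrite (aS_rmorph (comp_poly (- la - dd))) /=.
by rewrite comp_polyX !comp_polyM !comp_polyC.
Qed.

Lemma svbr_ev (a b : M) k (x z : C) :
  (svbr a b k).[x%:P].[z] = aB z x (1 / 2) (3 / 2)
    (fun g => (a g).[- x]) (fun g => (b g).[z + x]) k.
Proof.
rewrite svbrE /aB !horner_sum; apply: eq_bigr => g _.
rewrite !horner_sum; apply: eq_bigr => h _; rewrite !hornerM !horner_comp.
congr (_ * _ * _).
- by rewrite !hornerE.
- by rewrite !hornerE addrC.
- by case: g; case: h; case: k => //=; rewrite !hornerE.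
Qed.

Lemma sum_finsupp (V : nmodType) (u : {fsfun nat -> M with 0}) N (F : nat -> V) :
  (forall k, u k = 0 -> F k = 0) -> (forall k, (N <= k)%N -> u k = 0) ->
  \sum_(k <- finsupp u) F k = \sum_(k < N) F k.
Proof.
move=> F0 uN; rewrite -(big_mkord xpredT F) /index_iota subn0.
rewrite [RHS](bigID (mem (finsupp u))) /= [X in _ = _ + X]big1 ?addr0.
  rewrite -[RHS]big_filter; apply: perm_big; apply: uniq_perm.
  - exact: fset_uniq.
  - by rewrite filter_uniq ?iota_uniq.
  move=> k; rewrite mem_filter mem_iota /= add0n.
  case: (boolP (k \in finsupp u)) => //= kS.
  apply/esym; rewrite ltnNge; apply/negP => /uN e.
  by rewrite mem_finsupp e eqxx in kS.
by move=> k; rewrite memNfinsupp => /eqP /F0.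
Qed.

Lemma sum_svlbr (V : nmodType) (a b : M) k (F : nat -> V) :
  (forall n, svlbr a b n = 0 -> F n = 0) ->
  exists2 N, (size (svbr a b k) <= N)%N &
  \sum_(n <- finsupp (svlbr a b)) F n = \sum_(n < N) F n.
Proof.
move=> F0; exists (\max_k size (svbr a b k)); first exact: (leq_bigmax k).
apply: sum_finsupp => // n le_n; rewrite svlbrE; apply/ffunP=> j.
rewrite !ffunE nth_default //; apply: leq_trans le_n; exact: (leq_bigmax j).
Qed.

Lemma svlbr_ev (a b : M) k (x z : C) :
  \sum_(n <- finsupp (svlbr a b)) x ^+ n * (svlbr a b n k).[z]
    = (svbr a b k).[x%:P].[z].
Proof.
have [n e|N leN ->] := @sum_svlbr _ a b k
    (fun n => x ^+ n * (svlbr a b n k).[z]).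
  by rewrite e ffunE horner0 mulr0.
rewrite (horner_coef_wide _ leN) horner_sum; apply: eq_bigr => n _.
by rewrite svlbrE ffunE hornerM mulrC -rmorphXn hornerC.
Qed.

Lemma svlbr_coef (a b : M) n k : svlbr a b n k = (svbr a b k)`_n.
Proof. by rewrite svlbrE ffunE. Qed.

Lemma svlbr_skew (a b : M) n :
    svlbr a b n =
      - \sum_(k <- finsupp (svlbr b a))
          ((- 'X - 'X%:P : {poly {poly C}}) ^+ k)`_n *: svlbr b a k.
Proof.
apply/ffunP=> g; apply: (etrans (svlbr_coef a b n g)).
rewrite svbr_skew coefN ffunE sum_ffunE; congr (- _).
have [k e|N leN ->] := @sum_svlbr _ b a g
   (fun k => (((- 'X - 'X%:P : {poly {poly C}}) ^+ k)`_n *: svlbr b a k) g).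
  by rewrite e scaler0 ffunE.
rewrite /comp_poly (@horner_coef_wide _ N) ?size_map_polyC // coef_sum.
apply: eq_bigr => k _; rewrite coef_map coefCM mulrC ffunE.
by congr (_ * _); rewrite svlbr_coef.
Qed.


#[local] Opaque svlbr svbr.

(* [gensum u s]: the generating function of the double family u is s. *)
Definition gensum (u : nat -> nat -> C) (s : C -> C -> C) :=
  exists N0, forall N, (N0 <= N)%N -> forall x y : C,
    \sum_(m < N) \sum_(n < N) x ^+ m * y ^+ n * u m n = s x y.

Lemma gensum_eq u u' s s' : gensum u s -> (forall m n, u m n = u' m n) ->
  (forall x y, s x y = s' x y) -> gensum u' s'.
Proof.
move=> [N0 H] eu es; exists N0 => N le_N x y; rewrite -es -(H N) //.
by apply: eq_bigr => m _; apply: eq_bigr => n _; rewrite eu.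
Qed.

Lemma gensumD u u' s s' : gensum u s -> gensum u' s' ->
  gensum (fun m n => u m n + u' m n) (fun x y => s x y + s' x y).
Proof.
move=> [N H] [N' H']; exists (maxn N N') => K; rewrite geq_max => /andP[h h'] x y.
rewrite -(H K) // -(H' K) // -big_split /=; apply: eq_bigr => m _.
by rewrite -big_split /=; apply: eq_bigr => n _; rewrite mulrDr.
Qed.

Lemma gensumZ c u s : gensum u s ->
  gensum (fun m n => u m n * c) (fun x y => s x y * c).
Proof.
move=> [N H]; exists N => K h x y; rewrite -(H K) // mulr_suml.
apply: eq_bigr => m _; rewrite mulr_suml; apply: eq_bigr => n _.
by rewrite mulrA.
Qed.

Lemma gensum_sum (I : Type) (r : seq I) u s : (forall i, gensum (u i) (s i)) ->
  gensum (fun m n => \sum_(i <- r) u i m n) (fun x y => \sum_(i <- r) s i x y).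
Proof.
move=> H; elim: r => [|i r IH].
  exists 0 => N _ x y; rewrite big_nil big1 // => m _; rewrite big1 // => n _.
  by rewrite big_nil mulr0.
apply: gensum_eq (gensumD (H i) IH) _ _ => *; by rewrite big_cons.
Qed.

Lemma gensum_poly2 (p : PP) :
  gensum (fun m n => p`_m`_n) (fun x y => p.[x%:P].[y]).
Proof.
exists (maxn (size p) (\max_(m < size p) size (p`_m)%R)) => N.
rewrite geq_max => /andP[h1 /bigmax_leqP h2] x y.
rewrite (horner_coef_wide _ h1) horner_sum; apply: eq_bigr => m _.
rewrite hornerM -rmorphXn hornerC /= (@horner_coef_wide _ N).
  by rewrite mulr_suml; apply: eq_bigr => n _; ring.
case: (ltnP m (size p)) => [lt_m|le_m]; first exact: (h2 (Ordinal lt_m)).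
by rewrite nth_default ?size_poly0.
Qed.

Lemma gensum_l (p : P) n' :
  gensum (fun m n => (n == n')%:R * p`_m) (fun x y => y ^+ n' * p.[x]).
Proof.
apply: gensum_eq (gensum_poly2 (p^:P * ('X^n')%:P)) _ _.
  by move=> m n; rewrite coefMC coef_map coefCM coefXn mulrC.
by move=> x y; rewrite hornerM hornerC horner_map !hornerE mulrC.
Qed.

Lemma gensum_r (p : P) m' :
  gensum (fun m n => (m == m')%:R * p`_n) (fun x y => x ^+ m' * p.[y]).
Proof.
apply: gensum_eq (gensum_poly2 (p *: 'X^m')) _ _.
  move=> m n; rewrite coefZ coefXn; case: eqP => _ /=;
  by rewrite ?(mulr1, mulr0, mul1r, mul0r, coef0).
by move=> x y; rewrite hornerZ hornerXn hornerM horner_exp hornerC mulrC.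
Qed.

Lemma poly_all0 (N : nat) (u : nat -> C) :
  (forall x, \sum_(m < N) x ^+ m * u m = 0) -> forall m, (m < N)%N -> u m = 0.
Proof.
move=> H m ltm; pose p := \poly_(m < N) u m.
have p0 x : p.[x] = 0.
  by rewrite horner_poly -[RHS](H x); apply: eq_bigr => i _; rewrite mulrC.
have -> : u m = p`_m by rewrite coef_poly ltm.
case: (eqVneq p 0) => [->|nz]; first by rewrite coef0.
have : (size [seq i%:R : C | i <- iota 0 (size p)] < size p)%N.
  apply: max_poly_roots => //; first by apply/allP => x _; rewrite /root p0.
  by rewrite map_inj_uniq ?iota_uniq // => i j /eqP; rewrite eqr_nat => /eqP.
by rewrite size_map size_iota ltnn.
Qed.

Lemma horner_ext (p q : P) : (forall z, p.[z] = q.[z]) -> p = q.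
Proof.
move=> H; apply/polyP=> m; apply/eqP; rewrite -subr_eq0 -coefB; apply/eqP.
have [le|lt] := leqP (size (p - q)) m; first by rewrite nth_default.
apply: (@poly_all0 (size (p - q)) (fun m => (p - q)`_m)) lt => x.
transitivity ((p - q).[x]); last by rewrite hornerD hornerN H subrr.
by rewrite horner_coef; apply: eq_bigr => i _; rewrite mulrC.
Qed.

Lemma gensum0 u : gensum u (fun _ _ => 0) -> forall m n, u m n = 0.
Proof.
move=> [N0 H] m n; pose N := maxn N0 (maxn m.+1 n.+1).
have ltm : (m < N)%N by rewrite !leq_max leqnn orbT.
have ltn : (n < N)%N by rewrite !leq_max leqnn !orbT.
have {}H := H N (leq_maxl _ _).
apply: (@poly_all0 N (fun n => u m n)) => // y.
apply: (@poly_all0 N (fun m => \sum_(n < N) y ^+ n * u m n)) => // x.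
rewrite -[RHS](H x y); apply: eq_bigr => i _; rewrite mulr_sumr.
by apply: eq_bigr => j _; rewrite mulrA.
Qed.

Definition evz z (p : PP) : P := map_poly (horner_eval z) p.

Lemma coef_evz z p m : (evz z p)`_m = (p`_m).[z].
Proof. by rewrite coef_map. Qed.

Lemma horner_evz z p x : (evz z p).[x] = p.[x%:P].[z].
Proof.
by rewrite -[RHS]/(horner_eval z p.[x%:P]) -horner_map /= /horner_eval hornerC.
Qed.


Lemma svbr0r (a : M) k : svbr a 0 k = 0.
Proof.
have := svbr_lr (-1) a 0 0 k.
by rewrite scaler0 addr0 !rmorphN !rmorph1 ?comp_polyC mulN1r addNr.
Qed.

Lemma svlbr_ev0 (b c : M) (F : M -> P) : F 0 = 0 ->
  forall n m, (F (svlbr b c n))`_m =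
  \sum_(i <- finsupp (svlbr b c)) (n == i)%:R * (F (svlbr b c i))`_m.
Proof.
move=> F0 n m; case: (boolP (n \in finsupp (svlbr b c))) => nS.
  rewrite (bigD1_seq n) ?fset_uniq //= eqxx mul1r big1 ?addr0 // => i.
  by rewrite eq_sym => /negPf->; rewrite mul0r.
rewrite big_seq big1; last first.
  move=> i iS; case: eqP => [e|_]; last by rewrite mul0r.
  by rewrite e iS in nS.
by move: nS; rewrite memNfinsupp => /eqP ->; rewrite F0 coef0.
Qed.

Lemma svlbr_evz (a v : M) m g z :
  (svlbr a v m g).[z] = (evz z (svbr a v g))`_m.
Proof. by rewrite coef_evz svlbrE ffunE. Qed.

Lemma gensum_lbr (a b c : M) g z :
  gensum (fun m n => (svlbr a (svlbr b c n) m g).[z])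
    (fun x y => aB z x (1 / 2) (3 / 2) (fun k => (a k).[- x])
       (fun k => (svbr b c k).[y%:P].[z + x]) g)
  /\ gensum (fun m n => (svlbr a (svlbr b c m) n g).[z])
    (fun x y => aB z y (1 / 2) (3 / 2) (fun k => (a k).[- y])
       (fun k => (svbr b c k).[x%:P].[z + y]) g).
Proof.
pose F v := evz z (svbr a v g).
have F0 : F 0 = 0 by rewrite /F svbr0r /evz map_poly0.
have E n m : (svlbr a (svlbr b c n) m g).[z] = (F (svlbr b c n))`_m.
  exact: svlbr_evz.
split.
  have H := gensum_sum (finsupp (svlbr b c))
    (fun i => gensum_l (F (svlbr b c i)) i).
  apply: (gensum_eq H) => [m n|x y]; first exact: esym (etrans (E n m) (svlbr_ev0 b c F0 n m)).
  under eq_bigr do rewrite horner_evz svbr_ev.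
  by rewrite aB_sumr; apply: eq_aB => // k; exact: svlbr_ev.
have H := gensum_sum (finsupp (svlbr b c))
  (fun i => gensum_r (F (svlbr b c i)) i).
apply: (gensum_eq H) => [m n|x y]; first exact: esym (etrans (E m n) (svlbr_ev0 b c F0 m n)).
under eq_bigr do rewrite horner_evz svbr_ev.
by rewrite aB_sumr; apply: eq_aB => // k; exact: svlbr_ev.
Qed.

Lemma svlbr_jacobi (a b c : M) m n :
    svlbr a (svlbr b c n) m =
      \sum_(j <- finsupp (svlbr a b)) \sum_(k <- finsupp (svlbr (svlbr a b j) c))
          (('X^j * ('X + 'X%:P) ^+ k : {poly {poly C}})`_m`_n)%:P
            *: svlbr (svlbr a b j) c k
      + svlbr b (svlbr a c m) n.
Proof.
apply/ffunP=> g; rewrite ffunE; apply: horner_ext => z.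
have [H1 _] := gensum_lbr a b c g z.
have [_ H2] := gensum_lbr b a c g z.
pose co j k := ('X^j * ('X + 'X%:P) ^+ k : PP).
have H3 := gensum_sum (finsupp (svlbr a b)) (fun j =>
  gensum_sum (finsupp (svlbr (svlbr a b j) c)) (fun k =>
  gensumZ (svlbr (svlbr a b j) c k g).[z] (gensum_poly2 (co j k)))).
have H := gensumD H1 (gensumZ (-1) (gensumD H3 H2)).
have {}H := gensum0 (gensum_eq H (fun _ _ => erefl _) _).
apply/eqP; rewrite -subr_eq0 hornerD -mulrN1; apply/eqP.
rewrite -[RHS](H _ m n).
  congr (_ + (_ + _) * _).
  rewrite sum_ffunE horner_sum; apply: eq_bigr => j _.
  rewrite sum_ffunE horner_sum; apply: eq_bigr => k _.
  by rewrite ffunE hornerM hornerC.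
move=> x y {H H1 H2 H3}.
apply/eqP; rewrite mulrN1 subr_eq0; apply/eqP.
rewrite (eq_bigr (fun j => x ^+ j * aB z (x + y) (1 / 2) (3 / 2)
    (fun h => (svlbr a b j h).[- (x + y)]) (fun h => (c h).[z + (x + y)]) g)).
  rewrite aB_suml.
  rewrite (@eq_aB _ _ _ _ _ _ _ _ _ _ (fun k => svlbr_ev a b k x (- (x + y)))
    (fun _ => erefl)).
  rewrite [LHS](@eq_aB _ _ _ _ _ _ _ _ _ _ (fun _ => erefl)
    (fun k => svbr_ev b c k y (z + x))).
  rewrite aB_jacobi /=; congr (_ + _); apply: eq_aB => // h.
  - rewrite svbr_ev; apply: eq_aB => // k; congr (_.[_]); ring.
  - by rewrite addrA.
  - rewrite svbr_ev; apply: eq_aB => // k; congr (_.[_]); ring.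
move=> j _; rewrite -svbr_ev -svlbr_ev mulr_sumr; apply: eq_bigr => k _.
rewrite mulrA; congr (_ * _).
rewrite /co hornerM !horner_exp hornerD !hornerX hornerC hornerM.
by rewrite !horner_exp hornerD !hornerC hornerX.
Qed.


Lemma extSV_addE (v w : M) k : (v + w) k = v k + w k.
Proof. by rewrite ffunE. Qed.

Lemma extSV_scaleE (p : P) (v : M) k : (p *: v) k = p * v k.
Proof. by rewrite ffunE. Qed.

Lemma extSV_oppE (v : M) k : (- v) k = - v k.
Proof. by rewrite ffunE. Qed.

Lemma svlbr_linearl (c : C) (a a' b : M) n :
  svlbr (c%:P *: a + a') b n = c%:P *: svlbr a b n + svlbr a' b n.
Proof.
apply/ffunP=> k; rewrite extSV_addE extSV_scaleE.
apply: (etrans (svlbr_coef _ _ _ _)); apply/esym.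
apply: (etrans (congr2 (fun u v => c%:P * u + v)
  (svlbr_coef a b n k) (svlbr_coef a' b n k))).
by rewrite svbr_ll coefD map_polyC comp_polyC coefCM.
Qed.

Lemma svlbr_linearr (c : C) (a b b' : M) n :
  svlbr a (c%:P *: b + b') n = c%:P *: svlbr a b n + svlbr a b' n.
Proof.
apply/ffunP=> k; rewrite extSV_addE extSV_scaleE.
apply: (etrans (svlbr_coef _ _ _ _)); apply/esym.
apply: (etrans (congr2 (fun u v => c%:P * u + v)
  (svlbr_coef a b n k) (svlbr_coef a b' n k))).
by rewrite svbr_lr coefD map_polyC comp_polyC coefCM.
Qed.

Lemma svbr0l (b : M) k : svbr 0 b k = 0.
Proof.
have := svbr_ll (-1) 0 0 b k.
by rewrite scaler0 addr0 !rmorphN !rmorph1 ?comp_polyC mulN1r addNr.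
Qed.

Lemma svbr_Xl (a b : M) k : svbr ('X *: a) b k = - (la * svbr a b k).
Proof.
have := svbr_ll 'X a 0 b k.
by rewrite addr0 svbr0l addr0 map_polyX comp_polyX mulNr.
Qed.

Lemma svbr_Xr (a b : M) k : svbr a ('X *: b) k = (la + dd) * svbr a b k.
Proof.
have := svbr_lr 'X a b 0 k.
by rewrite addr0 svbr0r addr0 map_polyX comp_polyX.
Qed.

Lemma svlbr_dl (a b : M) n :
  svlbr ('X *: a) b n = - (if n is m.+1 then svlbr a b m else 0).
Proof.
apply/ffunP=> k; apply: (etrans (svlbr_coef _ _ _ _)).
rewrite extSV_oppE svbr_Xl coefN coefXM; congr (- _).
by case: n => [|n]; [rewrite ffunE | rewrite svlbr_coef].
Qed.

Lemma svlbr_dr (a b : M) n :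
  svlbr a ('X *: b) n =
    'X *: svlbr a b n + (if n is m.+1 then svlbr a b m else 0).
Proof.
apply/ffunP=> k; rewrite extSV_addE extSV_scaleE.
apply: (etrans (svlbr_coef _ _ _ _)).
rewrite svbr_Xr mulrDl coefD coefXM coefCM addrC; congr (_ + _).
  by congr (_ * _); rewrite svlbr_coef.
by case: n => [|n]; [rewrite ffunE | rewrite svlbr_coef].
Qed.

Definition extSV : lieConformalAlgebra C :=
  LieConformalAlgebra svlbr_linearl svlbr_linearr svlbr_dl svlbr_dr
    svlbr_skew svlbr_jacobi.

Definition svgen (g : svGen) : extSV := [ffun g' => (g' == g)%:R].

Lemma svgen_free (v : extSV) : v = \sum_g (v : M) g *: svgen g.
Proof.
apply/ffunP=> k; rewrite sum_ffunE (bigD1 k) //= !ffunE eqxx big1 => [|g].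
  by rewrite addr0 /GRing.scale /= mulr1.
by rewrite eq_sym !ffunE => /negPf->; rewrite scaler0.
Qed.

Lemma lbr_svgen (g h : svGen) n :
  lbr (svgen g) (svgen h) n = [ffun k => (svstruct g h k)`_n].
Proof.
rewrite [LHS]svlbrE; apply/ffunP=> k; rewrite !ffunE; congr (_`_n).
rewrite svbrE svstructE /aB (bigD1 g) //= (bigD1 h) //= !ffunE !eqxx.
rewrite !rmorph1 !mul1r big1 => [|h' /negPf hh]; last first.
  by rewrite !ffunE hh !rmorph0 mulr0 mul0r.
rewrite addr0 big1 ?addr0 // => g' /negPf gg.
by rewrite big1 // => h' _; rewrite !ffunE gg !rmorph0 !mul0r.
Qed.

End ExtendedSchrodingerVirasoro.

(* Main.v *)
Require Import Defs.
From mathcomp Require Import all_boot all_order all_algebra all_fingroup.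
From mathcomp Require Import finmap reals complex mpoly.

(** The proof is a Cartan homotopy.  Write [D] for the action of the derivation
    on cochains, which is multiplication by [a + \sum_i 'X_i].  Any element [L]
    of a Lie conformal algebra gives a contraction [kappa], which inserts [L] as
    first argument and sets its variable to 0.  The anticommutator
    [d kappa + kappa d] is, up to sign, the action of the zeroth product by [L]
    on the arguments of a cochain.  The Virasoro element of the extended
    Schroedinger-Virasoro algebra acts by the derivation through its zeroth
    product ([extSV_L0]).  Each argument of a cochain turns the derivation into
    [- 'X_i], hence ([contract_codiff])
      [d kappa + kappa d = \sum_i 'X_i = D - a].
    As [kappa] commutes with [D] ([contract_coder]), it acts on the reduced
    complex, where [D] vanishes: multiplication by [- a] is homotopic to 0 there,
    so for [a != 0] the cohomology vanishes.  Explicitly, if [d gamma = D phi]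
    in positive degree, then
      [gamma = d (- a^-1 kappa gamma) + D (a^-1 (gamma - kappa phi))],
    where [kappa] preserves cochains ([contract_cochain]).  In degree 0, [D] is
    multiplication by [a], already invertible. *)

Set Implicit Arguments.
Unset Strict Implicit.
Unset Printing Implicit Defensive.

Import GRing.Theory.

Local Open Scope ring_scope.

(** * Substitution in multivariate polynomials *)

Section Substitution.
Variables (C : comNzRingType) (n k : nat).
Implicit Types (p : {mpoly C[n]}) (f : 'I_n -> {mpoly C[k]}).

Lemma eq_comp_mpoly f f' p :
  f =1 f' -> p \mPo [tuple f i | i < n] = p \mPo [tuple f' i | i < n].
Proof.
by move=> e; congr (p \mPo _); apply: eq_from_tnth => i; rewrite !tnth_mktuple.
Qed.

Lemma comp_mpoly_varU f i : ('X_i : {mpoly C[n]}) \mPo [tuple f i | i < n] = f i.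
Proof. by rewrite comp_mpolyXU -tnth_nth tnth_mktuple. Qed.

Lemma comp_mpoly_comp l f (h : 'I_k -> {mpoly C[l]}) p :
  (p \mPo [tuple f i | i < n]) \mPo [tuple h j | j < k] =
  p \mPo [tuple f i \mPo [tuple h j | j < k] | i < n].
Proof.
rewrite [p \mPo [tuple f i | i < n]]comp_mpolyEX [RHS]comp_mpolyEX raddf_sum /=.
apply: eq_bigr => m _; rewrite linearZ /=; congr (_ *: _).
rewrite !comp_mpolyX rmorph_prod; apply: eq_bigr => i _.
by rewrite rmorphXn /= !tnth_mktuple.
Qed.

End Substitution.

(** * Cochains *)

Section Cochains.
Variables (C : fieldType) (A : lieConformalAlgebra C).
Implicit Types n m : nat.

Lemma fcons0 T m (x : T) (f : 'I_m -> T) : fcons x f ord0 = x.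
Proof. by rewrite /fcons unlift_none. Qed.

Lemma fcons_lift T m (x : T) (f : 'I_m -> T) p : fcons x f (lift ord0 p) = f p.
Proof. by rewrite /fcons liftK. Qed.

Lemma ord_split m (P : 'I_m.+1 -> Prop) :
  P ord0 -> (forall p, P (lift ord0 p)) -> forall p, P p.
Proof. by move=> P0 Pl p; case: (unliftP ord0 p) => [q|] ->. Qed.

(** Skew-symmetry in the form used throughout: the variables are replaced by
    arbitrary polynomials, so that it applies below other substitutions, and
    the permuted families are only given pointwise, which leaves a case analysis
    on the index to the caller. *)
Lemma cochain_skew n (gamma : cofun A n) k (s : 'S_n)
    (v w : {ffun 'I_n -> A}) (F G : 'I_n -> {mpoly C[k]}) :
  is_cochain gamma -> (forall i, w i = v (s i)) -> (forall i, G i = F (s i)) ->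
  gamma w \mPo [tuple G i | i < n] =
    (-1) ^+ s * (gamma v \mPo [tuple F i | i < n]).
Proof.
case=> _ _ skew ew eG.
have -> : w = [ffun i => v (s i)] by apply/ffunP => i; rewrite ffunE ew.
have /(congr1 (comp_mpoly [tuple F i | i < n])) := skew v s.
rewrite rmorphM rmorph_sign /= => <-; rewrite comp_mpoly_comp.
by apply: eq_comp_mpoly => i; rewrite comp_mpoly_varU.
Qed.

Lemma upd_id n (v : {ffun 'I_n -> A}) i : upd v i (v i) = v.
Proof. by apply/ffunP => j; rewrite ffunE; case: eqP => [->|]. Qed.

Lemma cochain0 n (gamma : cofun A n) (v : {ffun 'I_n -> A}) i :
  is_cochain gamma -> v i = 0 -> gamma v = 0.
Proof.
case=> lin _ _ vi0; rewrite -(upd_id v i) vi0.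
have := lin v i (-1) 0 0.
by rewrite scaler0 addr0 scaleN1r addNr.
Qed.

Lemma cochain_lincomb n (c : C) (gamma gamma' : cofun A n) :
  is_cochain gamma -> is_cochain gamma' ->
  is_cochain (fun v => c *: gamma v + gamma' v).
Proof.
move=> [l1 d1 s1] [l2 d2 s2]; split.
- move=> v i b x y; rewrite l1 l2 !scalerDr !scalerA (mulrC c).
  by rewrite -!addrA; congr (_ + _); rewrite addrCA.
- by move=> v i x; rewrite d1 d2 mulrDr scalerAr.
- by move=> v s; rewrite raddfD /= linearZ /= s1 s2 mulrDr scalerAr.
Qed.

Lemma cochain_const0 n : is_cochain (fun _ => 0 : {mpoly C[n]}) (A := A).
Proof.
by split=> *; rewrite ?scaler0 ?addr0 ?mulr0 // comp_mpoly0.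
Qed.

Lemma cochainZ n (c : C) (gamma : cofun A n) :
  is_cochain gamma -> is_cochain (fun v => c *: gamma v).
Proof.
move=> hg; have := cochain_lincomb c hg (cochain_const0 n).
case=> l d s; split=> [v i b x y|v i x|v t].
- by have := l v i b x y; rewrite !addr0.
- by have := d v i x; rewrite !addr0.
- by have := s v t; rewrite !addr0.
Qed.

Lemma codiffZ n (c : C) (gamma : cofun A n) v :
  codiff (fun w => c *: gamma w) v = c *: codiff gamma v.
Proof.
case: n gamma v => [|m] gamma v /=; first by rewrite scaler0.
rewrite scaler_sumr; apply: eq_bigr => i _.
rewrite scaler_sumr; apply: eq_bigr => j _.
rewrite scalerAr scaler_sumr; congr (_ * _); apply: eq_bigr => k _.
by rewrite linearZ /= scalerAr.
Qed.

(** * Omitted indices and sums over brackets *)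

Lemma omit20l m (j : 'I_m.+1) p :
  omit2 ord0 (lift ord0 j) p = lift ord0 (lift j p).
Proof.
rewrite /omit2; have -> : inord (ord0 : 'I_m.+2) = ord0 :> 'I_m.+1.
  by apply: val_inj; rewrite /= inordK.
by apply: val_inj; rewrite /= /bump /= !add1n ltnS addnS.
Qed.

Lemma omit2_lift0 m (i j : 'I_m.+2) : (i < j)%N ->
  omit2 (lift ord0 i) (lift ord0 j) ord0 = ord0.
Proof.
move=> ltij; apply: val_inj; rewrite /= inordK ?lift0 //.
by rewrite ltnS (leq_trans ltij) // -ltnS ltn_ord.
Qed.

Lemma omit2_lift_lift m (i j : 'I_m.+2) p : (i < j)%N ->
  omit2 (lift ord0 i) (lift ord0 j) (lift ord0 p) = lift ord0 (omit2 i j p).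
Proof.
move=> ltij; have ltim : (i < m.+1)%N by rewrite (leq_trans ltij) // -ltnS ltn_ord.
apply: val_inj; rewrite /= !inordK ?lift0 //.
by rewrite /bump /= !add1n !ltnS !addnS !ltnS.
Qed.

(** The substitution of 0 for the variable of [L] kills the positive powers of
    that variable, so that only the zeroth product survives.  When the zeroth
    product vanishes, 0 lies outside the support and the term to recover is
    absent from the sum, whence the second hypothesis. *)
Lemma sum_fsfun0 (V : nmodType) (u : {fsfun nat -> A with 0}) (F : nat -> V) :
  (forall k, k != 0%N -> F k = 0) -> (u 0%N = 0 -> F 0%N = 0) ->
  \sum_(k <- finsupp u) F k = F 0%N.
Proof.
move=> F0 u0; case: (boolP (0%N \in finsupp u)) => in0.
  by rewrite (bigD1_seq 0%N) ?fset_uniq //= big1 ?addr0.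
rewrite u0 ?big_seq ?big1 //.
  by move=> k kin; apply: F0; apply: contraNneq in0 => <-.
by apply/eqP; rewrite -memNfinsupp.
Qed.

(** * The homotopy *)

Section Contraction.
Variable L : A.

Definition contract n (gamma : cofun A n.+1) : cofun A n := fun v =>
  gamma [ffun p => fcons L v p] \mPo
    [tuple fcons 0 (fun q => 'X_q : {mpoly C[n]}) p | p < n.+1].

Lemma fcons_upd n (v : {ffun 'I_n -> A}) i x :
  [ffun p => fcons L (upd v i x) p] =
  upd [ffun p => fcons L v p] (lift ord0 i) x.
Proof.
apply/ffunP; apply: ord_split => [|p].
  by rewrite !ffunE !fcons0 (negPf (neq_lift _ _)).
by rewrite !ffunE !fcons_lift ffunE (inj_eq lift_inj).
Qed.

(** A permutation of the arguments of the contraction is a permutation of the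
    arguments of [gamma] that fixes the first one, with the same signature. *)
Lemma contract_cochain n (gamma : cofun A n.+1) :
  is_cochain gamma -> is_cochain (contract gamma).
Proof.
move=> hg; have [lin sesq _] := hg; rewrite /contract; split.
- by move=> v i c x y; rewrite !fcons_upd lin raddfD /= linearZ.
- move=> v i x; rewrite !fcons_upd sesq rmorphM rmorphN /=.
  by rewrite comp_mpoly_varU fcons_lift.
- move=> v s; rewrite comp_mpoly_comp.
  rewrite (@cochain_skew _ _ _ (lift_perm ord0 ord0 s) [ffun p => fcons L v p] _
    (fcons 0 (fun q => 'X_q)) _ hg) ?odd_lift_perm //.
  + by apply: ord_split => [|p];
      rewrite !ffunE (lift_perm_id, lift_perm_lift) !(fcons0, fcons_lift) ?ffunE.
  + apply: ord_split => [|p].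
      by rewrite lift_perm_id !fcons0 comp_mpoly0.
    by rewrite lift_perm_lift !fcons_lift comp_mpoly_varU.
Qed.

(** The variable of [L] is set to 0, so it leaves [\sum_i 'X_i]. *)
Lemma contract_coder (a : C) n (gamma : cofun A n.+1) v :
  contract (coder a gamma) v = coder a (contract gamma) v.
Proof.
rewrite /contract /coder rmorphM rmorphD rmorph_sum /= comp_mpolyC.
rewrite big_ord_recl comp_mpoly_varU fcons0 add0r.
congr ((_ + _) * _); apply: eq_bigr => i _.
by rewrite comp_mpoly_varU fcons_lift.
Qed.

Hypothesis L0 : forall x : A, lbr L x 0%N = 'X *: x.

(** Cartan's formula for [L].  In the differential of [gamma] at
    [(L, v_0, ..., v_m)], the brackets [[L, v_j]] give [\sum_j 'X_j * gamma v].
    In the brackets [[v_i, v_j]], moving [L] in front of the bracket costs a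
    sign and leaves the differential of the contraction. *)
Lemma contract_codiff m (gamma : cofun A m.+1) v : is_cochain gamma ->
  contract (codiff gamma) v =
  (\sum_i 'X_i) * gamma v - codiff (contract gamma) v.
Proof.
move=> hg; have [_ sesq _] := hg.
pose X0 n (p : 'I_n.+1) := fcons 0 (fun q => 'X_q : {mpoly C[n]}) p.
have X0E n i : ('X_i : {mpoly C[n.+1]}) \mPo [tuple X0 n p | p < n.+1] = X0 n i.
  exact: comp_mpoly_varU.
rewrite /= {1}/contract /codiffS big_ord_recl raddfD /=; congr (_ + _).
  rewrite raddf_sum /= big_mkcond /= big_ord_recl ltnn add0r mulr_suml.
  apply: eq_bigr => j _.
  rewrite /= rmorphM rmorph_sign raddf_sum /= !ffunE fcons0 fcons_lift.
  pose w := upd v j ('X *: v j).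
  (* The argument ['X *: v j] has to move from the first place to the [j]-th,
     by a cycle of signature [(-1) ^+ j]. *)
  have term0 (b : A) : b = 'X *: v j ->
     gamma [ffun p => fcons b ([ffun p => fcons L v p] \o omit2 ord0 (lift ord0 j)) p]
      \mPo [tuple fcons ('X_ord0 + 'X_(lift ord0 j))
               (fun q => 'X_(omit2 ord0 (lift ord0 j) q)) p | p < m.+1]
      \mPo [tuple X0 m.+1 p | p < m.+2] = - (-1) ^+ j * ('X_j * gamma v).
    move=> ->; rewrite comp_mpoly_comp.
    rewrite (@cochain_skew _ _ _ (lift_perm ord0 j 1) w _ (fun q => 'X_q) _ hg).
    + rewrite comp_mpoly_id sesq upd_id odd_lift_perm odd_perm1 addbF /= signr_odd.
      by rewrite !mulNr mulrN.
    + apply: ord_split => [|p].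
        by rewrite ffunE fcons0 lift_perm_id ffunE eqxx.
      rewrite ffunE fcons_lift lift_perm_lift perm1 /= !ffunE.
      by rewrite eq_sym (negPf (neq_lift _ _)) omit20l fcons_lift.
    + apply: ord_split => [|p].
        rewrite fcons0 lift_perm_id rmorphD /= !X0E /X0 fcons0 add0r.
        by rewrite fcons_lift.
      by rewrite fcons_lift lift_perm_lift perm1 X0E omit20l /X0 fcons_lift.
  rewrite (@sum_fsfun0 _ (lbr L (v j))).
  - rewrite expr0 mul1r term0 ?L0 // add0n /bump /= add1n exprS mulN1r.
    by rewrite mulrA mulrNN -expr2 sqrr_sign mul1r.
  - move=> k k0; rewrite rmorphM rmorphXn /= X0E /X0 fcons0 expr0n (negPf k0).
    by rewrite mul0r.
  - move=> e0; rewrite (cochain0 (i := ord0) hg) ?comp_mpoly0 ?mulr0 ?comp_mpoly0 //.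
    by rewrite ffunE fcons0.
(* With a single argument besides [L] there is no further bracket, and the
   contraction has degree 0, where the differential vanishes. *)
case: m gamma v hg sesq => [|m] gamma v hg sesq.
  rewrite big_ord1 /= big_pred0 ?comp_mpoly0 ?oppr0 // => j.
  by rewrite ltnNge -ltnS ltn_ord.
rewrite raddf_sum -sumrN; apply: eq_bigr => i _.
rewrite raddf_sum -sumrN /= big_mkcond /= big_ord_recl /= add0r [RHS]big_mkcond /=.
apply: eq_bigr => j _; rewrite /bump /= !add1n ltnS.
case: ifP => // ltij.
rewrite rmorphM rmorph_sign /= addSn addnS !exprS !mulN1r opprK -mulrN.
congr (_ * _); rewrite !ffunE !fcons_lift raddf_sum -sumrN /=.
apply: eq_bigr => k _; rewrite rmorphM rmorphXn /= X0E /X0 fcons_lift -mulrN.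
congr (_ * _); rewrite /contract !comp_mpoly_comp.
pose B := [ffun p => fcons L (fcons (lbr (v i) (v j) k) (v \o omit2 i j)) p].
pose H := fcons (0 : {mpoly C[m.+2]}) (fcons ('X_i + 'X_j) (fun q => 'X_(omit2 i j q))).
(* Both sides are values of [gamma] on the bracket, [L] and the remaining
   arguments: exchange the first two. *)
rewrite (@cochain_skew _ _ _ (tperm ord0 (lift ord0 ord0)) B _ H _ hg).
- rewrite odd_tperm neq_lift mulN1r; congr (- _).
  have -> : B = [ffun p => fcons L [ffun q => fcons (lbr (v i) (v j) k) (v \o omit2 i j) q] p].
    by apply/ffunP; apply: ord_split => [|p]; rewrite !ffunE ?fcons0 // !fcons_lift ffunE.
  apply: eq_comp_mpoly; apply: ord_split => [|p].
    by rewrite /H !fcons0 comp_mpoly0.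
  by rewrite /H !fcons_lift comp_mpoly_varU.
- apply: ord_split => [|]; [|apply: ord_split => [|p]].
  + by rewrite tpermL !ffunE fcons0 fcons_lift fcons0.
  + by rewrite tpermR !ffunE fcons_lift !fcons0 /= omit2_lift0 // ffunE fcons0.
  + rewrite tpermD ?neq_lift // ?(inj_eq lift_inj) ?neq_lift // !ffunE !fcons_lift /=.
    by rewrite omit2_lift_lift // ffunE fcons_lift.
- apply: ord_split => [|]; [|apply: ord_split => [|p]].
  + by rewrite tpermL /H fcons_lift !fcons0 rmorphD /= !X0E /X0 !fcons_lift.
  + by rewrite tpermR /H fcons_lift !fcons0 X0E omit2_lift0 // /X0 fcons0.
  + rewrite tpermD ?neq_lift // ?(inj_eq lift_inj) ?neq_lift // /H !fcons_lift.
    by rewrite X0E omit2_lift_lift // /X0 fcons_lift.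
Qed.

(** Contracting [d gamma = D phi] and inserting the result into Cartan's formula
    gives [a *: gamma = D (gamma - kappa phi) - d (kappa gamma)]. *)
Lemma reduced_vanishing (a : C) q : a != 0 -> reduced_cohomology_vanishes A a q.
Proof.
move=> a0; case: q => [|m] gamma [hg [phi hphi dg]] /=.
  exists (fun v => a^-1 *: gamma v) => [|v]; first exact: cochainZ.
  rewrite subr0 /coder big_ord0 addr0 mul_mpolyC scalerA.
  by rewrite divff // scale1r.
pose psi v := - a^-1 *: contract gamma v.
exists psi; first exact/cochainZ/contract_cochain.
exists (fun v => a^-1 *: (- 1 *: contract phi v + gamma v)) => [|v].
  by apply: cochainZ; apply: cochain_lincomb => //; apply: contract_cochain.
have := contract_codiff v hg.
have -> : contract (codiff gamma) v = coder a (contract phi) v.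
  rewrite -contract_coder; congr (_ \mPo _).
  by rewrite -dg subr0.
move/eqP; rewrite eq_sym subr_eq addrC -subr_eq => /eqP e.
rewrite /psi codiffZ -e scaleNr opprK /coder scaleN1r -scalerAr mulrDr mulrN.
rewrite (mulrDl _ _ (gamma v)) mul_mpolyC [in RHS]addrC -addrA.
by rewrite [in RHS]scalerDr scalerA mulVf // scale1r addrC.
Qed.

End Contraction.
End Cochains.

(** * The extended Schroedinger-Virasoro algebra *)

(** On every generator [g], [[L_lambda g]] is ['X *: g] plus a multiple of
    [lambda]; on [p *: g], sesquilinearity adds the factor [p] evaluated at
    [lambda + 'X], which is [p] itself at [lambda = 0]. *)
Lemma extSV_L0 (C : numFieldType) (x : extSV C) : lbr (svgen C svL) x 0%N = 'X *: x.
Proof.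
apply/ffunP => k; rewrite [LHS]svlbr_coef -horner_coef0 svbrE aBE [RHS]ffunE.
have evL g : (svgen C svL g)^:P \Po - 'X = ((g == svL)%:R : {poly {poly C}}).
  by rewrite ffunE; case: eqP => _; rewrite ?rmorph1 ?rmorph0.
have evx g : ((x g)^:P \Po ('X + 'X%:P)).[0] = x g.
  by rewrite horner_comp !hornerE /= [LHS]comp_polyXr.
rewrite !evL /=; case: k => /=; rewrite !(mul1r, mul0r, addr0, subr0);
  by rewrite hornerM evx !hornerE; apply: mulrC.
Qed.

Theorem theorem4p4 (R : realType) (a : R[i]) (a_neq0 : a <> 0) (q : nat) :
  reduced_cohomology_vanishes (extSV R[i]) a q.
Proof.
by apply: (reduced_vanishing (@extSV_L0 _)); apply/eqP.
Qed.
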